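(* Suppose that disintegrability holds (as defined in the context). (i) Let $X_1,\dots,X_n$ be bounded variables satisfying weak irrelevance (as defined in the context), with $\sup X_i-\inf X_i\le B_i$ for each $i$, and let $B=\max_{1\le i\le n}B_i>0$. Then for any $\epsilon>0$, $$\underline{P}\Big(\underline{\mu}_n-\epsilon<\frac{\sum_{i=1}^nX_i}{n}<\overline{\mu}_n+\epsilon\Big)\ge1-2e^{-2n\epsilon^2/B^2}.$$ (ii) Let $X_1,X_2,\dots$ be a sequence of bounded variables such that $X_1,\dots,X_n$ satisfy weak irrelevance for every $n$, with $\sup X_i-\inf X_i\le B_i$ for each $i$ and $0<B=\sup_iB_i<\infty$. Then for any $\epsilon>0$ there is a positive integer $N$ such that for any positive integer $N'$, $$\underline{P}\Big(\forall n\in[N,N+N']:\ \underline{\mu}_n-\epsilon<\frac{\sum_{i=1}^nX_i}{n}<\overline{\mu}_n+\epsilon\Big)>1-2\epsilon.$$ Here $\underline{\mu}_n=\frac1n\sum_{i=1}^n\underline{E}[X_i]$ and $\overline{\mu}_n=\frac1n\sum_{i=1}^n\overline{E}[X_i]$.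
   Context: Variables are real-valued functions on a possibility space $\Omega$; an event is identified with its indicator function. An expectation functional $E$ maps bounded variables to real numbers and satisfies: (1) if $\alpha\le X\le\beta$ pointwise, with $\alpha,\beta$ real numbers, then $\alpha\le E[X]\le\beta$; (2) $E[X+Y]=E[X]+E[Y]$. It induces a finitely additive probability measure by $P(A)=E[A]$. A nonempty set $\mathcal{K}$ of expectation functionals is fixed. Lower and upper expectations are $\underline{E}[X]=\inf_{E\in\mathcal{K}}E[X]$ and $\overline{E}[X]=\sup_{E\in\mathcal{K}}E[X]$; $\underline{P}(A)=\underline{E}[A]$ and $\overline{P}(A)=\overline{E}[A]$. In the countably additive setting ''variable'' and ''event'' mean measurable ones with respect to a fixed $\sigma$-algebra. In $[N,N+N']$, $n$ ranges over integers. Notation: $X_{1:k}$ stands for $X_1,\dots,X_k$, and $A(X_{1:k})$ denotes an event defined by $X_{1:k}$, i.e. of the form $\{(X_1,\dots,X_k)\in S\}$. Conditioning is elementwise: given an event $A$, each $E\in\mathcal{K}$ (with measure $P$) has a conditional expectation functional $E[\cdot|A]$ with $E[X|A]P(A)=E[XA]$, and $\underline{E}[X|A]$, $\overline{E}[X|A]$ are the infimum and supremum of the resulting $E[X|A]$. There are two set-ups. (I) Full conditional measures: for each member of $\mathcal{K}$, $E[\cdot|A]$ is defined for every nonempty $A$, it is the expectation functional of $P(\cdot|A)$, and $P(\cdot|\cdot)$ satisfies, for nonempty conditioning events, $P(C|C)=1$; $P(A|C)\ge0$; $P(A\cup B|C)=P(A|C)+P(B|C)$ for disjoint $A,B$;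 $P(A\cap B|C)=P(A|B\cap C)P(B|C)$ if $B\cap C\ne\emptyset$; with $P(\cdot|\Omega)=P$. (II) $E[\cdot|A]$ is defined only when $P(A)>0$; then $\underline{E}[X|A]$ and $\overline{E}[X|A]$ are the infimum and supremum over those members of $\mathcal{K}$ with $P(A)>0$, and are defined when $\overline{P}(A)>0$. Weak irrelevance of $X_1,\dots,X_n$ means that at least one of the following holds: (W1) in set-up (I), for any $i\in\{2,\dots,n\}$ and any nonempty event $A(X_{1:i-1})$, $\underline{E}[X_i|A(X_{1:i-1})]=\underline{E}[X_i]$ and $\overline{E}[X_i|A(X_{1:i-1})]=\overline{E}[X_i]$; (W2) in set-up (II), for any $i\in\{2,\dots,n\}$ and any event $A(X_{1:i-1})$ with $\overline{P}(A(X_{1:i-1}))>0$, the same two equalities hold. Disintegrability means $\overline{E}[W]\le\overline{E}\big[\overline{E}[W|Z]\big]$ for the nonnegative bounded $W$ and the $Z$ of interest, namely $W$ a function of $X_{1:k+1}$ and $Z=X_{1:k}$, for all $k\ge1$ for which $X_{k+1}$ is among the variables considered. Here $\overline{E}[W|Z]$ is the variable taking the value $\overline{E}[W|Z=z]$ where $Z=z$ (and $0$ where this is undefined). The paper regards disintegrability as also holding when every $P$ is countably additive, with conditional expectations given variables taken in the usual Kolmogorov sense, in the elementwise form $E_P[W]=E_P[E_P[W|Z]]$ for every $P$; this form is also admitted. *)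

(* Defs.v *)
From HB Require Import structures.
From mathcomp Require Import all_boot all_order all_algebra.
From mathcomp Require Import all_classical all_reals all_analysis.

Set Implicit Arguments.
Unset Strict Implicit.
Unset Printing Implicit Defensive.

Import Order.TTheory GRing.Theory Num.Theory.
Import numFieldNormedType.Exports.

Local Open Scope classical_set_scope.
Local Open Scope ring_scope.

(* The possibility space is a measurableType whose measurable sets are the
   events.  The finitely additive setting, in which every subset is an event
   and every bounded function a variable, is the case of the power-set
   sigma-algebra; see [framework]. *)

Section CredalSets.
Context {d : measure_display} {T : measurableType d} {R : realType}.
Implicit Types (X W g : T -> R) (A C : set T).

Definition variable X : Prop :=
  measurable_fun [set: T] X /\ [bounded X w | w in [set: T]].

(* A functional is a total function; only its values on bounded variables are
   constrained, and only those are ever used. *)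
Definition expectation_functional (E : (T -> R) -> R) : Prop :=
  (forall X (a b : R), variable X -> (forall w, a <= X w <= b) ->
     a <= E X <= b) /\
  (forall X Y : T -> R, variable X -> variable Y -> E (X \+ Y) = E X + E Y).

(* A member of the credal set: E together with its conditional functionals,
   [cexpect M A X] being E[X|A].  Under [PositiveProbability] the value for P(A) = 0 is
   meaningless and never used. *)
Record member := Member {
  expect : (T -> R) -> R ;
  cexpect : set T -> (T -> R) -> R }.

Definition prob (M : member) A : R := expect M \1_A.
Definition cprob (M : member) A C : R := cexpect M C \1_A.

Definition conditional_functional (M : member) A : Prop :=
  expectation_functional (cexpect M A) /\
  (forall X, variable X ->
     cexpect M A X * prob M A = expect M (X \* \1_A)).

Definition full_conditional_measure (M : member) : Prop :=
  [/\ forall C, measurable C -> C !=set0 -> cprob M C C = 1,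
      forall A C, measurable A -> measurable C -> C !=set0 ->
        0 <= cprob M A C,
      forall A B C, measurable A -> measurable B -> measurable C ->
        C !=set0 -> A `&` B = set0 ->
        cprob M (A `|` B) C = cprob M A C + cprob M B C,
      forall A B C, measurable A -> measurable B -> measurable C ->
        (B `&` C) !=set0 ->
        cprob M (A `&` B) C = cprob M A (B `&` C) * cprob M B C &
      forall A, measurable A -> cprob M A [set: T] = prob M A].

Inductive setup := FullConditional | PositiveProbability.

Definition admissible_member (su : setup) (M : member) : Prop :=
  expectation_functional (expect M) /\
  match su with
  | FullConditional =>
      full_conditional_measure M /\
      (forall A, measurable A -> A !=set0 -> conditional_functional M A)
  | PositiveProbability =>
      forall A, measurable A -> 0 < prob M A -> conditional_functional M A
  end.

Definition countably_additive (M : member) : Prop :=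
  sigma_additive (fun A => (prob M A)%:E).

(* The first disjunct is the finitely additive setting, the second the countably
   additive one. *)
Definition framework (K : set member) : Prop :=
  (forall A, measurable A) \/ (forall M, K M -> countably_additive M).

(* The sets below are nonempty and bounded whenever K is a nonempty set of
   admissible members and X is a variable, so [inf] and [sup] are genuine. *)
Definition lexpect (K : set member) X : R := inf [set expect M X | M in K].
Definition uexpect (K : set member) X : R := sup [set expect M X | M in K].
Definition lprob (K : set member) A : R := lexpect K \1_A.
Definition uprob (K : set member) A : R := uexpect K \1_A.

Definition conditioning_members (su : setup) (K : set member) A : set member :=
  match su with
  | FullConditional => K
  | PositiveProbability => K `&` [set M | 0 < prob M A]
  end.

Definition conditioning_defined (su : setup) (K : set member) A : Prop :=
  match su with
  | FullConditional => A !=set0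
  | PositiveProbability => 0 < uprob K A
  end.

Definition lcexpect su (K : set member) X A : R :=
  inf [set cexpect M A X | M in conditioning_members su K A].
Definition ucexpect su (K : set member) X A : R :=
  sup [set cexpect M A X | M in conditioning_members su K A].

(* Sequences of variables are indexed from 0: [X i] is the (i+1)-st variable,
   and [firsts X k] is the random vector of the first k of them. *)
Definition firsts (X : nat -> T -> R) (k : nat) (w : T) : 'rV[R]_k :=
  \row_(j < k) X j w.

Definition defined_by (X : nat -> T -> R) (k : nat) A : Prop :=
  measurable A /\ exists S : set 'rV[R]_k, A = firsts X k @^-1` S.

Definition irrelevant_given su (K : set member) (X : nat -> T -> R)
    (i : nat) A : Prop :=
  lcexpect su K (X i) A = lexpect K (X i) /\
  ucexpect su K (X i) A = uexpect K (X i).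

(* Weak irrelevance of X 0, ..., X n.-1. *)
Definition weak_irrelevance su (K : set member) (X : nat -> T -> R)
    (n : nat) : Prop :=
  (su = FullConditional /\
   forall i A, (0 < i < n)%N -> defined_by X i A -> A !=set0 ->
     irrelevant_given su K X i A) \/
  (su = PositiveProbability /\
   forall i A, (0 < i < n)%N -> defined_by X i A -> 0 < uprob K A ->
     irrelevant_given su K X i A).

(* The variable whose value where X_{1:k} = z is the upper expectation of W
   given {X_{1:k} = z}, and 0 where the latter is undefined. *)
Definition ucexpect_given su (K : set member) W (X : nat -> T -> R) (k : nat)
    : T -> R :=
  fun w =>
    let A := firsts X k @^-1` [set firsts X k w] in
    if `[< conditioning_defined su K A >] then ucexpect su K W A else 0.

Definition of_interest (X : nat -> T -> R) (k : nat) W : Prop :=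
  [/\ variable W, forall w, 0 <= W w &
      exists f : 'rV[R]_k.+1 -> R, W = f \o firsts X k.+1].

(* g is a bounded version of the Kolmogorov conditional expectation of W given
   X_{1:k}: it is measurable for the sigma-algebra generated by X_{1:k} and has
   the same expectation as W on each of its members. *)
Definition kolmogorov_version (M : member) W (X : nat -> T -> R) (k : nat) g
    : Prop :=
  let sigmaZ := g_sigma_preimage (fun j : 'I_k => X j) in
  [/\ variable g,
      forall Y : set R, measurable Y -> sigmaZ (g @^-1` Y) &
      forall A, sigmaZ A -> expect M (g \* \1_A) = expect M (W \* \1_A)].

(* [idx i] says that X i is among the variables considered.  For k >= 1, the
   variable following X_{1:k} is X k.  The first disjunct includes that the
   conditional upper expectation is a variable, without which its upper
   expectation would not make sense; this is automatic in the finitely additive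
   setting.  In the second one, versions exist by Radon-Nikodym. *)
Definition disintegrability su (K : set member) (X : nat -> T -> R)
    (idx : set nat) : Prop :=
  (forall k W, (0 < k)%N -> idx k -> of_interest X k W ->
     variable (ucexpect_given su K W X k) /\
     uexpect K W <= uexpect K (ucexpect_given su K W X k)) \/
  (forall M, K M -> countably_additive M /\
     forall k W g, (0 < k)%N -> idx k -> of_interest X k W ->
       kolmogorov_version M W X k g -> expect M W = expect M g).

Definition lmu (K : set member) (X : nat -> T -> R) (n : nat) : R :=
  n%:R^-1 * \sum_(i < n) lexpect K (X i).
Definition umu (K : set member) (X : nat -> T -> R) (n : nat) : R :=
  n%:R^-1 * \sum_(i < n) uexpect K (X i).

Definition mean_within (K : set member) (X : nat -> T -> R) (n : nat)
    (eps : R) : set T :=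
  [set w | lmu K X n - eps < (\sum_(i < n) X i w) / n%:R < umu K X n + eps].

End CredalSets.

Arguments member {d} T R.

(* Main.v *)
Require Import Defs.
From HB Require Import structures.
From mathcomp Require Import all_boot all_order all_algebra.
From mathcomp Require Import all_classical all_reals all_analysis.
From mathcomp Require Import measurable_realfun.
From mathcomp Require Import ring lra.

Import Order.TTheory GRing.Theory Num.Theory.
Import numFieldNormedType.Exports.

Local Open Scope classical_set_scope.
Local Open Scope ring_scope.

(** The result is a Hoeffding inequality that is uniform over the credal set.
    Fix a member [M] and consider the centred variables
    [X i - uexpect K (X i)] for the upper deviations and
    [lexpect K (X i) - X i] for the lower ones; call either family [Y].

    Weak irrelevance, multiplied out by
    [cexpect M A (X i) * prob M A = expect M (X i \* \1_A)], says that
    [expect M (Y i \* \1_A) <= 0] for every event [A] defined by the variables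
    before [X i] ([weak_irrelevance_expect]); an event with [prob M A = 0] only
    contributes 0.  Thus [Y] behaves like a sequence of supermartingale
    differences, tested against events of the past.  A bounded nonnegative
    function [h] of the past is a uniform limit of staircases
    [delta * \sum_j \1_{h >= j * delta}], so the inequality passes from events to
    [expect M (Y i \* h) <= 0] using finite additivity alone
    ([expect_mul_level_sets_le0]).

    This is all that the exponential moment method needs.  With
    [h = expR (s * \sum_(j < i) Y j)], convexity bounds [expR (s * Y i)] by
    [expR (s ^+ 2 * B ^+ 2 / 8) + b * Y i] with [b >= 0]
    ([hoeffding_affine_bound]); multiplying by [h] and taking expectations, the
    second term can be dropped.  By induction the exponential moment of the sum
    of [n] terms is at most [expR (n * s ^+ 2 * B ^+ 2 / 8)]
    ([expect_expR_sum_le]), and Markov's inequality at [s = 4 * eps / B ^+ 2]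
    gives the tail bound ([hoeffding_tail]).

    Adding the two tails bounds [prob M (mean_within K X n eps)] from below by a
    number independent of [M], which is (i).  Those bounds have the form
    [1 - 2 * r ^+ n] with [r < 1], so (ii) follows from the union bound and the
    convergence of the geometric series. *)

(** * Real inequalities behind the exponential moment method *)

Lemma nondecreasing_from0 (R : realType) (f df : R -> R) :
  (forall x : R, is_derive x 1 f (df x)) -> (forall x, 0 <= x -> 0 <= df x) ->
  forall x, 0 <= x -> f 0 <= f x.
Proof.
move=> fdf df0 x x0.
have fc : {within `[0, x], continuous f}.
  apply: continuous_subspaceT => y; apply: differentiable_continuous.
  by apply/derivable1_diffP; case: (fdf y).
have [c] := MVT_segment x0 (fun y _ => fdf y) fc.
rewrite in_itv /= subr0 => /andP[c0 _] fx0.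
by rewrite -subr_ge0 fx0 mulr_ge0 ?df0.
Qed.

(** Hoeffding's lemma for a two-point distribution.  The difference [F] of the
    logarithms of the two sides vanishes at 0 together with [F'], and
    [F'' = (q - 1/2) ^+ 2 >= 0], where [q] is the success probability after
    exponential tilting; integrating twice gives the inequality. *)
Lemma hoeffding_two_point (R : realType) (p u : R) : 0 <= p <= 1 -> 0 <= u ->
  1 - p + p * expR u <= expR (p * u + u ^+ 2 / 8).
Proof.
move=> /andP[p0 p1] u0.
pose D (x : R) := 1 - p + p * expR x.
have Dgt0 x : 0 < D x.
  rewrite /D; have [->|pn0] := eqVneq p 0; first by rewrite mul0r addr0 subr0.
  by rewrite ltr_wpDl ?subr_ge0// mulr_gt0 ?expR_gt0// lt_neqAle eq_sym pn0.
have dD (x : R) : is_derive x 1 D (p * expR x).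
  by rewrite /D; apply: is_derive_eq; rewrite /GRing.scale/=; ring.
pose F (x : R) := p * x + x ^+ 2 / 8 - ln (D x).
pose F' (x : R) := p + x / 4 - p * expR x / D x.
have dF (x : R) : is_derive x 1 F (F' x).
  have dln := is_derive1_comp (is_derive1_ln (Dgt0 x)) (dD x).
  rewrite /F; apply: is_derive_eq; rewrite /F' /GRing.scale/=.
  by field; rewrite gt_eqF.
have dF' (x : R) : is_derive x 1 F' ((p * expR x / D x - 1 / 2) ^+ 2).
  have dV := @is_deriveV R D x _ 1 (lt0r_neq0 (Dgt0 x)) (dD x).
  rewrite /F'; apply: is_derive_eq; rewrite /GRing.scale/=.
  by field; rewrite gt_eqF.
have F'0 x : 0 <= x -> 0 <= F' x.
  move=> x0; have := nondecreasing_from0 _ _ _ dF' (fun x _ => sqr_ge0 _) x x0.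
  by rewrite /F' /D expR0 mulr1 subrK divr1 mul0r addr0 subrr.
have := nondecreasing_from0 _ _ _ dF F'0 u u0.
rewrite /F /D expR0 !mulr1 subrK ln1 expr0n/= mul0r mulr0 addr0 subr0 subr_ge0.
by rewrite -ler_expR lnK// posrE Dgt0.
Qed.

(** This is Hoeffding's lemma as a pointwise inequality: the chord of the
    convex function [expR (s * y)] over [[a, a + B]], whose value at [y = 0] is
    the exponential moment of the centred law on the two end points.  Being
    affine in [y], it can be integrated against any functional, and [b >= 0]
    lets a nonpositive mean be used in place of a zero mean. *)
Lemma hoeffding_affine_bound (R : realType) (a B s : R) :
  0 < B -> a <= 0 -> 0 <= s ->
  exists2 b : R, 0 <= b & forall y, a <= y <= a + B ->
    expR (s * y) <= expR (s ^+ 2 * B ^+ 2 / 8) + b * y.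
Proof.
move=> B0 a0 s0.
have [aB0|/ltW aB0] := leP (a + B) 0.
  (* All values of y are nonpositive, so the exponential is at most 1. *)
  exists 0 => // y /andP[ay yaB]; rewrite mul0r addr0 ler_expR.
  have y0 := le_trans yaB aB0.
  apply: (@le_trans _ _ 0); first by rewrite mulr_ge0_le0.
  by have := mulr_ge0 (sqr_ge0 s) (sqr_ge0 B); lra.
have Bn0 : B != 0 by rewrite gt_eqF.
pose A0 := expR (s * a); pose A1 := expR (s * (a + B)).
have A01 : A0 <= A1 by rewrite ler_expR ler_wpM2l// lerDl ltW.
exists ((A1 - A0) / B) => [|y /andP[ay yaB]].
  by apply: divr_ge0; rewrite ?subr_ge0// ltW.
(* The chord lies above the graph because both end points lie above the
   tangent at y. *)
have chord : expR (s * y) <= A0 + (A1 - A0) / B * (y - a).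
  have e0 : A0 >= expR (s * y) * (1 + s * (a - y)).
    rewrite /A0 [s * a](_ : _ = s * y + s * (a - y)); last by ring.
    by rewrite expRD ler_wpM2l ?expR_ge0// expR_ge1Dx.
  have e1 : A1 >= expR (s * y) * (1 + s * (a + B - y)).
    rewrite /A1 [s * (a + B)](_ : _ = s * y + s * (a + B - y)); last by ring.
    by rewrite expRD ler_wpM2l ?expR_ge0// expR_ge1Dx.
  have t0 : 0 <= (y - a) / B by apply: divr_ge0; rewrite ?subr_ge0// ltW.
  have t1 : 0 <= 1 - (y - a) / B.
    by rewrite subr_ge0 ler_pdivrMr// mul1r lerBlDl.
  have := lerD (ler_wpM2l t1 e0) (ler_wpM2l t0 e1).
  rewrite [X in X <= _ -> _](_ : _ = expR (s * y)); last by field.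
  by rewrite [X in _ <= X -> _](_ : _ = A0 + (A1 - A0) / B * (y - a)); last by field.
apply: le_trans chord _.
rewrite mulrBr addrA addrAC lerD2r.
have p01 : 0 <= - a / B <= 1.
  by rewrite ler_pdivlMr// ler_pdivrMr// mul0r mul1r; lra.
have := hoeffding_two_point R (- a / B) (s * B) p01 (mulr_ge0 s0 (ltW B0)).
have A0gt : 0 < A0 by exact: expR_gt0.
rewrite -(ler_pM2l A0gt) {2}/A0 -expRD.
rewrite [s * a + _](_ : _ = s ^+ 2 * B ^+ 2 / 8); last by field.
have -> : A1 = A0 * expR (s * B) by rewrite /A0 /A1 -expRD mulrDr.
by apply: le_trans; rewrite le_eqVlt; apply/orP; left; apply/eqP; field.
Qed.

(** * Closure properties of variables *)

Section Variables.
Context {d : measure_display} {T : measurableType d} {R : realType}.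
Implicit Types (X Y : T -> R) (A : set T).

Lemma variableP X :
  variable X <-> measurable_fun setT X /\ exists C, forall w, `|X w| <= C.
Proof.
split=> [] [mX bX]; split => //.
    have [C [_ XC]] := bX; exists (C + 1) => w.
  by apply: (XC (C + 1)); rewrite ?ltrDl.
have [C XC] := bX; exists C; split; first exact: num_real.
by move=> M CM w _; rewrite /= (le_trans (XC w))// ltW.
Qed.

Lemma variable_cst (c : R) : variable (fun _ : T => c).
Proof. by apply/variableP; split; [exact: measurable_cst | exists `|c|]. Qed.

Lemma variableD X Y : variable X -> variable Y -> variable (fun w => X w + Y w).
Proof.
move=> /variableP[mX [C XC]] /variableP[mY [D YD]]; apply/variableP; split.
  exact: measurable_funD.
by exists (C + D) => w; rewrite (le_trans (ler_normD _ _))// lerD.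
Qed.

Lemma variableM X Y : variable X -> variable Y -> variable (fun w => X w * Y w).
Proof.
move=> /variableP[mX [C XC]] /variableP[mY [D YD]]; apply/variableP; split.
  exact: measurable_funM.
by exists (C * D) => w; rewrite normrM ler_pM.
Qed.

Lemma variableN X : variable X -> variable (fun w => - X w).
Proof.
move=> /variableP[mX [C XC]]; apply/variableP; split; first exact: measurable_funN.
by exists C => w; rewrite normrN.
Qed.

Lemma variableB X Y : variable X -> variable Y -> variable (fun w => X w - Y w).
Proof. by move=> vX vY; apply: variableD => //; exact: variableN. Qed.

Lemma variable_sum (n : nat) (X : nat -> T -> R) :
  (forall i, (i < n)%N -> variable (X i)) ->
  variable (fun w => \sum_(i < n) X i w).
Proof.
elim: n => [|n IH] vX.
  by under eq_fun do rewrite big_ord0; exact: variable_cst.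
under eq_fun do rewrite big_ord_recr/=.
by apply: variableD; [apply: IH => i /ltnW; exact: vX | exact: vX].
Qed.

Lemma variable_expR X : variable X -> variable (fun w => expR (X w)).
Proof.
move=> /variableP[mX [C XC]]; apply/variableP; split.
  exact: measurableT_comp (@measurable_expR R) mX.
exists (expR C) => w; rewrite ger0_norm ?expR_ge0// ler_expR.
by rewrite (le_trans (ler_norm _)).
Qed.

Lemma variable_indic A : measurable A -> variable (\1_A : T -> R).
Proof.
move=> mA; apply/variableP; split; first exact: measurable_indic.
exists 1 => w; rewrite indicE.
by case: (w \in A); rewrite ?normr1 ?normr0.
Qed.

Lemma measurable_le_variable X Y : variable X -> variable Y ->
  measurable [set w | X w <= Y w].
Proof.
move=> [mX _] [mY _].
by have := measurable_fun_le (@measurableT _ T) mX mY; rewrite setTI.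
Qed.

Lemma measurable_lt_variable X Y : variable X -> variable Y ->
  measurable [set w | X w < Y w].
Proof.
move=> vX vY; rewrite (_ : [set w | _] = ~` [set w | Y w <= X w]).
  by apply: measurableC; exact: measurable_le_variable.
by apply/seteqP; split => w /=; rewrite ltNge => /negP.
Qed.

End Variables.

(** * Linearity and monotonicity of expectation functionals *)

(** Expectation functionals are only assumed additive; real homogeneity comes
    from this fact, applied to [a |-> E (a * X)]. *)
Lemma bounded_additive_homogeneous (R : realType) (f : R -> R) (C : R) :
  {morph f : x y / x + y} -> (forall x, `|f x| <= C * `|x|) ->
  forall a, f a = a * f 1.
Proof.
move=> fD fC a.
have f0 : f 0 = 0.
  by apply/eqP; rewrite -normr_le0 (le_trans (fC 0))// normr0 mulr0.
have fMn x n : f (x *+ n) = f x *+ n.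
  by elim: n => [|n IH]; rewrite ?mulr0n ?f0// !mulrS fD IH.
have fN x : f (- x) = - f x.
  by apply/eqP; rewrite -addr_eq0 -fD addNr f0.
have fMz x (z : int) : f (x *~ z) = f x *~ z.
  by case: z => n; rewrite ?NegzE ?mulrNz ?fN fMn.
have C0 : 0 <= C by have := fC 1; rewrite normr1 mulr1; apply: le_trans.
(* f (n a) is computed exactly at the integer part of n a, with an error that
   is independent of n; dividing by n removes it. *)
have key n : `|f a - a * f 1| *+ n <= C + `|f 1|.
  have -> : `|f a - a * f 1| *+ n = `|f (a *+ n) - (a *+ n) * f 1|.
    by rewrite fMn mulrnAl -mulrnBl normrMn.
  set x := a *+ n; set z := Num.floor x.
  have /andP[zx xz] := floor_itv x.
  have r0 : 0 <= x - z%:~R by rewrite subr_ge0.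
  have r1 : x - z%:~R <= 1 by move: xz; rewrite intrD1; lra.
  have -> : f x - x * f 1 = f (x - z%:~R) - (x - z%:~R) * f 1.
    by rewrite fD fN fMz; rewrite -[f 1 *~ z]mulrzl; ring.
  rewrite (le_trans (ler_normB _ _))// lerD//.
    by rewrite (le_trans (fC _))// ger0_norm// ler_piMr.
  by rewrite normrM ger0_norm// ler_piMl.
apply/eqP; rewrite -subr_eq0 -normr_le0 leNgt; apply/negP => e0.
have := key (Num.bound ((C + `|f 1|) / `|f a - a * f 1|)).
apply/negP; rewrite -ltNge -mulr_natr mulrC -ltr_pdivrMr//.
by apply: archi_boundP; rewrite divr_ge0// addr_ge0.
Qed.

Section ExpectationFunctionals.
Context {d : measure_display} {T : measurableType d} {R : realType}.
Context {E : (T -> R) -> R} (HE : expectation_functional E).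
Implicit Types X Y : T -> R.

Lemma expect_bound X a b : variable X -> (forall w, a <= X w <= b) ->
  a <= E X <= b.
Proof. exact: HE.1. Qed.

Lemma expectD X Y : variable X -> variable Y ->
  E (fun w => X w + Y w) = E X + E Y.
Proof. exact: HE.2. Qed.

Lemma expect_cst c : E (fun=> c) = c.
Proof.
apply/eqP; rewrite eq_le andbC.
by apply: (expect_bound _ _ _ (variable_cst c)) => w; rewrite lexx.
Qed.

Lemma expect_norm X C : variable X -> (forall w, `|X w| <= C) -> `|E X| <= C.
Proof.
by move=> vX XC; rewrite ler_norml expect_bound// => w; rewrite -ler_norml.
Qed.

Lemma expectZ c X : variable X -> E (fun w => c * X w) = c * E X.
Proof.
move=> vX; have /variableP[_ [C XC]] := vX.
have vZ a : variable (fun w => a * X w) by exact: variableM (variable_cst _) vX.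
have E1 : E (fun w => 1 * X w) = E X.
  by congr E; apply/funext => w; rewrite mul1r.
rewrite -E1.
apply: (bounded_additive_homogeneous _ (fun a => E (fun w => a * X w)) C)
  => [a b|a].
  by rewrite -expectD//; congr E; apply/funext => w; rewrite mulrDl.
by apply: expect_norm => // w; rewrite normrM mulrC ler_wpM2r.
Qed.

Lemma expect_ge0 X : variable X -> (forall w, 0 <= X w) -> 0 <= E X.
Proof.
move=> vX X0; have /variableP[_ [C XC]] := vX.
have X0C w : 0 <= X w <= C by rewrite X0/= (le_trans (ler_norm _)).
by have /andP[] := expect_bound X 0 C vX X0C.
Qed.

Lemma expectN X : variable X -> E (fun w => - X w) = - E X.
Proof.
move=> vX; rewrite -mulN1r -expectZ//.
by congr E; apply/funext => w; rewrite mulN1r.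
Qed.

Lemma expectB X Y : variable X -> variable Y ->
  E (fun w => X w - Y w) = E X - E Y.
Proof. by move=> vX vY; rewrite expectD ?expectN//; exact: variableN. Qed.

Lemma le_expect X Y : variable X -> variable Y -> (forall w, X w <= Y w) ->
  E X <= E Y.
Proof.
move=> vX vY XY; rewrite -subr_ge0 -expectB//; apply: expect_ge0.
  exact: variableB.
by move=> w; rewrite subr_ge0.
Qed.

Lemma expect_sum n (X : nat -> T -> R) :
  (forall i, (i < n)%N -> variable (X i)) ->
  E (fun w => \sum_(i < n) X i w) = \sum_(i < n) E (X i).
Proof.
elim: n => [|n IH] vX.
  by under eq_fun do rewrite big_ord0; rewrite big_ord0 expect_cst.
under eq_fun do rewrite big_ord_recr/=.
rewrite expectD ?big_ord_recr/= ?IH//.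
- by move=> i /ltnW; exact: vX.
- by apply: variable_sum => i /ltnW; exact: vX.
- exact: vX.
Qed.

End ExpectationFunctionals.

(** * Concentration when the past gives no favourable event *)

(** The sum is the integer part of [x], written as a layer-cake sum so that
    expectations of its terms involve level sets only. *)
Lemma unit_staircase_approx (R : realType) (x : R) (N : nat) :
  0 <= x -> x <= N%:R ->
  0 <= x - \sum_(j < N) (j.+1%:R <= x)%R%:R <= 1.
Proof.
move=> x0; suff : (x <= N%:R ->
    0 <= x - \sum_(j < N) (j.+1%:R <= x)%R%:R <= 1) /\
  (N%:R <= x -> \sum_(j < N) (j.+1%:R <= x)%R%:R = N%:R :> R) by case.
elim: N => [|N [IHle IHge]]; first by rewrite big_ord0 subr0; split => //; lra.
rewrite big_ord_recr/= -[N.+1%:R]natr1; split => [xN|Nx].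
  have [Nx|/ltW xN'] := leP N%:R x.
    by rewrite IHge//; have [?|?] := leP (N%:R + 1) x; rewrite ?mulr1n ?mulr0n; lra.
  by have [?|?] := leP (N%:R + 1) x; [lra | rewrite mulr0n addr0; exact: IHle].
by rewrite Nx IHge//; lra.
Qed.

Section MartingaleDifferences.
Context {d : measure_display} {T : measurableType d} {R : realType}.
Context {E : (T -> R) -> R} (HE : expectation_functional E).
Implicit Types (A : set T) (Y : nat -> T -> R).

(** The extension from events to functions.  Approximating [m * h] from below
    by its integer part, a sum of indicators of level sets of [h], costs at most
    [D = sup |U|], whatever [m] is; hence [m * E (U h) <= D] for all [m].  Only
    finite additivity is available, and the uniform approximation makes it
    sufficient. *)
Lemma expect_mul_level_sets_le0 (U h : T -> R) :
  variable U -> variable h -> (forall w, 0 <= h w) ->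
  (forall t, E (fun w => U w * \1_[set v | t <= h v] w) <= 0) ->
  E (fun w => U w * h w) <= 0.
Proof.
move=> vU vh h0 levels; have /variableP[_ [D UD]] := vU.
have vlevel t : variable (\1_[set v | t <= h v] : T -> R).
  by apply: variable_indic; exact: measurable_le_variable (variable_cst t) vh.
have scaled (m : nat) : E (fun w => U w * h w) *+ m <= D.
  case: m => [|m].
    rewrite mulr0n; have := expect_norm HE U D vU UD.
    exact: le_trans.
  have m0 : 0 < m.+1%:R :> R by rewrite ltr0n.
  have /variableP[_ [C hC]] := vh.
  pose N := Num.bound (m.+1%:R * C).
  pose st j w : R := U w * \1_[set v | j.+1%:R / m.+1%:R <= h v] w.
  have vst j : variable (st j) by exact: variableM vU (vlevel _).
  have vsum := variable_sum N st (fun j _ => vst j).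
  have vUh := variableM _ _ vU vh.
  have vmUh := variableM _ _ (variable_cst m.+1%:R) vUh.
  have Est : E (fun w => \sum_(j < N) st j w) <= 0.
    by rewrite expect_sum// sumr_le0// => j _; exact: levels.
  rewrite -mulr_natl -(expectZ HE)//.
  apply: le_trans (_ : E (fun w => \sum_(j < N) st j w + D) <= _).
    apply: le_expect => // [|w]; first exact: variableD vsum (variable_cst D).
    have : 0 <= m.+1%:R * h w - \sum_(j < N) (j.+1%:R <= m.+1%:R * h w)%R%:R <= 1.
      apply: unit_staircase_approx; first by rewrite mulr_ge0.
      rewrite (@le_trans _ _ (m.+1%:R * C))//.
        by rewrite ler_pM2l// (le_trans (ler_norm _)).
      apply/ltW/archi_boundP; rewrite mulr_ge0//.
      exact: le_trans (normr_ge0 _) (hC w).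
    have -> : \sum_(j < N) st j w =
        U w * \sum_(j < N) (j.+1%:R <= m.+1%:R * h w)%R%:R.
      rewrite mulr_sumr; apply: eq_bigr => j _.
      rewrite /st indicE -ler_pdivrMl// [_^-1 * _]mulrC.
      by congr (_ * _%:R); congr nat_of_bool; apply/idP/idP; rewrite inE.
    set S := \sum_(_ < _) _ => /andP[S0 S1].
    have -> : m.+1%:R * (U w * h w) = U w * S + U w * (m.+1%:R * h w - S) by ring.
    rewrite lerD2l (le_trans (ler_norm _))// normrM (ger0_norm S0).
    by rewrite (le_trans _ (UD w))// ler_piMr.
  rewrite (expectD HE)//; last exact: variable_cst.
  by rewrite (expect_cst HE) -lerBrDr subrr.
rewrite leNgt; apply/negP => e0.
have D0 : 0 <= D by have := scaled 0; rewrite mulr0n.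
have := scaled (Num.bound (D / E (fun w => U w * h w))).
apply/negP; rewrite -ltNge -mulr_natr mulrC -ltr_pdivrMr//.
by apply: archi_boundP; rewrite divr_ge0// ltW.
Qed.

Lemma defined_by_setT Y n : defined_by Y n setT.
Proof. by split; [exact: measurableT | exists setT; rewrite preimage_setT]. Qed.

Lemma defined_by_sum_level Y n (g : R -> R) (t : R) :
  variable (fun w => g (\sum_(i < n) Y i w)) ->
  defined_by Y n [set w | t <= g (\sum_(i < n) Y i w)].
Proof.
move=> vg; split; first exact: measurable_le_variable (variable_cst t) vg.
exists [set z : 'rV[R]_n | t <= g (\sum_(i < n) z ord0 i)].
have sumE w : \sum_(i < n) firsts Y n w ord0 i = \sum_(i < n) Y i w.
  by apply: eq_bigr => i _; rewrite mxE.
by apply/seteqP; split => w /=; rewrite sumE.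
Qed.

Context (Y : nat -> T -> R) (n : nat) (B : R).
Hypothesis B_gt0 : 0 < B.
Hypothesis vY : forall i, (i < n)%N -> variable (Y i).
Hypothesis rangeY : forall i, (i < n)%N ->
  exists a, forall w, a <= Y i w <= a + B.
Hypothesis pastY : forall i, (i < n)%N -> forall A, defined_by Y i A ->
  E (fun w => Y i w * \1_A w) <= 0.

(** The factor of the past, [h], is a nonnegative function of a sum of past
    variables, so the affine bound on the factor of the present may be
    multiplied by it, and the linear term then has nonpositive expectation. *)
Lemma expect_expR_sum_le k s : (k <= n)%N -> 0 <= s ->
  E (fun w => expR (s * \sum_(i < k) Y i w)) <= expR (s ^+ 2 * B ^+ 2 / 8) ^+ k.
Proof.
have vexp j : (j <= n)%N -> variable (fun w => expR (s * \sum_(i < j) Y i w)).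
  move=> jn; apply: variable_expR; apply: variableM; first exact: variable_cst.
  by apply: variable_sum => i ij; apply: vY; exact: leq_trans ij jn.
move=> + s0; elim: k => [_|k IH kn].
  under eq_fun do rewrite big_ord0 mulr0 expR0.
  by rewrite (expect_cst HE) expr0.
have vYk := vY _ kn; have [a Yka] := rangeY _ kn.
pose h w := expR (s * \sum_(i < k) Y i w).
have vh : variable h.
  exact: vexp (ltnW kn).
have h0 w : 0 <= h w by exact: expR_ge0.
have vYh := variableM _ _ vYk vh.
(* The sure event belongs to the past, so the mean of Y k is nonpositive. *)
have a0 : a <= 0.
  have := pastY _ kn _ (defined_by_setT Y k); rewrite indicT.
  under eq_fun do rewrite mulr1.
  apply: le_trans; by have /andP[] := expect_bound HE _ _ _ vYk Yka.
have [b b0 affine] := hoeffding_affine_bound R a B s B_gt0 a0 s0.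
have Yh : E (fun w => Y k w * h w) <= 0.
  apply: expect_mul_level_sets_le0 => // t; apply: pastY => //.
  exact: (defined_by_sum_level _ _ (fun x => expR (s * x)) _ (vexp _ (ltnW kn))).
set c := expR (s ^+ 2 * B ^+ 2 / 8) in affine IH *.
apply: (@le_trans _ _ (E (fun w => c * h w + b * (Y k w * h w)))).
  apply: (le_expect HE) => [||w].
  - exact: vexp.
  - by apply: variableD; apply: variableM => //; exact: variable_cst.
  - rewrite big_ord_recr/= mulrDr expRD -/(h w).
    rewrite [X in _ <= X](_ : _ = h w * (c + b * Y k w)); last by ring.
    by rewrite ler_wpM2l// affine.
rewrite (expectD HE) ?(expectZ HE)//;
  try by apply: variableM => //; exact: variable_cst.
rewrite exprS (le_trans (_ : _ <= c * E h + 0))//.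
  by rewrite lerD2l mulr_ge0_le0.
by rewrite addr0 ler_wpM2l ?expR_ge0// IH// ltnW.
Qed.

Lemma hoeffding_tail eps : 0 < eps ->
  E \1_[set w | n%:R * eps <= \sum_(i < n) Y i w]
    <= expR (- (2 * n%:R * eps ^+ 2 / B ^+ 2)).
Proof.
(* This s minimizes the exponent s ^+ 2 * B ^+ 2 / 8 - s * eps. *)
move=> eps0; pose s := 4 * eps / B ^+ 2.
have s0 : 0 <= s by rewrite divr_ge0 ?mulr_ge0 ?sqr_ge0// ltW.
have vS := variable_sum n Y vY.
have vexp : variable (fun w => expR (s * \sum_(i < n) Y i w)).
  by apply/variable_expR/variableM => //; exact: variable_cst.
pose c := expR (- (s * (n%:R * eps))).
apply: (@le_trans _ _ (E (fun w => c * expR (s * \sum_(i < n) Y i w)))).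
  apply: (le_expect HE) => [||w].
  - by apply: variable_indic; exact: measurable_le_variable (variable_cst _) vS.
  - exact: variableM (variable_cst _) vexp.
  - rewrite indicE; case: (boolP (w \in _)) => [|_]; last first.
      by rewrite mulr0n; apply: mulr_ge0; exact: expR_ge0.
    rewrite inE /= => nS; rewrite mulr1n -expRD -[X in X <= _]expR0 ler_expR.
    by rewrite addrC -mulrBr; apply: mulr_ge0; rewrite ?subr_ge0.
rewrite (expectZ HE)//.
apply: (@le_trans _ _ (c * expR (s ^+ 2 * B ^+ 2 / 8) ^+ n)).
  by rewrite ler_wpM2l ?expR_ge0// expect_expR_sum_le.
rewrite -expRM_natl -expRD ler_expR le_eqVlt; apply/orP; left; apply/eqP.
by rewrite /s; field; rewrite gt_eqF.
Qed.

End MartingaleDifferences.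

(** * From weak irrelevance to bounds on the members of a credal set *)

Section CredalSetBounds.
Context {d : measure_display} {T : measurableType d} {R : realType}.
Context (su : setup) (K : set (member T R)).
Context (K_admissible : forall M, K M -> admissible_member su M).
Implicit Types (U : T -> R) (X : nat -> T -> R) (A : set T) (M : member T R).

(** Stated for a family [F] so as to serve the unconditional functionals as
    well as those given an event. *)
Lemma envelope_bounds (F : member T R -> (T -> R) -> R) (L : set (member T R))
    U M :
  (forall M', L M' -> expectation_functional (F M')) -> variable U -> L M ->
  inf [set F M' U | M' in L] <= F M U <= sup [set F M' U | M' in L].
Proof.
move=> HF vU LM; have /variableP[_ [C UC]] := vU.
have FC M' : L M' -> - C <= F M' U <= C.
  by move=> LM'; rewrite -ler_norml (expect_norm (HF _ LM')).
apply/andP; split.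
  apply: ge_inf; last by exists M.
  by exists (- C) => _ [M' /FC/andP[? _] <-].
apply: ub_le_sup; last by exists M.
by exists C => _ [M' /FC/andP[_ ?] <-].
Qed.

Lemma expect_functional M : K M -> expectation_functional (expect M).
Proof. by move=> /K_admissible[]. Qed.

Lemma expect_null_event U A M : K M -> variable U -> measurable A ->
  prob M A = 0 -> expect M (fun w => U w * \1_A w) = 0.
Proof.
move=> /expect_functional HM vU mA PA0; have /variableP[_ [C UC]] := vU.
have vA : variable (\1_A : T -> R) := variable_indic A mA.
have vUA := variableM _ _ vU vA; have vCA := variableM _ _ (variable_cst C) vA.
have UCA w : `|U w * \1_A w| <= C * \1_A w.
  by rewrite normrM (ger0_norm (x := \1_A w)) ?indicE ?ler0n// ler_wpM2r.
have CA0 : expect M (fun w => C * \1_A w) = 0.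
  by rewrite (expectZ HM)// -/(prob M A) PA0 mulr0.
apply/eqP; rewrite eq_le; apply/andP; split.
  rewrite -CA0; apply: (le_expect HM) => // w.
  exact: le_trans (ler_norm _) (UCA w).
rewrite -[leLHS]oppr0 -CA0 -(expectN HM)//.
apply: (le_expect HM) => // [|w]; first exact: variableN.
by have := UCA w; rewrite ler_norml => /andP[].
Qed.

Lemma prob_ge0 M A : K M -> measurable A -> 0 <= prob M A.
Proof.
move=> /expect_functional HM mA.
by apply: (expect_ge0 HM) => [|w]; [exact: variable_indic | rewrite indicE].
Qed.

Lemma conditional_member M A : K M -> measurable A -> 0 < prob M A ->
  [/\ A !=set0, conditioning_members su K A M & conditioning_defined su K A].
Proof.
move=> KM mA PA0; have HM := expect_functional M KM.
have An0 : A !=set0.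
  apply/set0P/eqP => A0; move: PA0.
  by rewrite /prob A0 indic0 (expect_cst HM) ltxx.
case: (su) => /=; split => //.
apply: lt_le_trans PA0 _.
by have /andP[] := envelope_bounds (@expect _ T R) K _ M expect_functional
  (variable_indic A mA) KM.
Qed.

Lemma conditioning_members_functional M A : measurable A -> A !=set0 ->
  conditioning_members su K A M -> conditional_functional M A.
Proof.
move=> mA An0; move: K_admissible; case: (su) => /= Kadm.
  by move=> /Kadm[_ [_]]; apply.
by move=> [/Kadm[_ HM]]; exact: HM.
Qed.

(** Multiplying by [prob M A] puts the two set-ups on the same footing and
    covers null events, about which conditioning on events of positive
    probability is silent.  The first variable, on which weak irrelevance imposes
    nothing, obeys the same bounds because the only events defined by no variable
    are the empty and the sure one. *)
Lemma weak_irrelevance_expect X n i A M : K M -> variable (X i) ->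
  weak_irrelevance su K X n -> (i < n)%N -> defined_by X i A ->
  lexpect K (X i) * prob M A <= expect M (fun w => X i w * \1_A w)
    <= uexpect K (X i) * prob M A.
Proof.
move=> KM vX wirr iltn defA; have [mA [S AS]] := defA.
have HM := expect_functional M KM.
have := prob_ge0 M A KM mA; rewrite le_eqVlt => /predU1P[PA0|PA0].
  by rewrite (expect_null_event _ _ M)// -PA0 !mulr0 lexx.
have [An0 KAM defd] := conditional_member M A KM mA PA0.
have [i0|i0] := posnP i.
  have AT : A = setT.
    have [w0 Aw0] := An0; apply/seteqP; split => // w _.
    suff e : firsts X i w = firsts X i w0 by move: Aw0; rewrite AS /= e.
    by apply/rowP => j; have := ltn_ord j; rewrite {2}i0.
  rewrite AT /prob indicT (expect_cst HM) !mulr1.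
  under eq_fun do rewrite mulr1.
  exact: (envelope_bounds (@expect _ T R) K _ M expect_functional vX KM).
have [] : irrelevant_given su K X i A.
  have iin : (0 < i < n)%N by rewrite i0.
  move: defd; case: wirr => -[-> H] /= defd; exact: H.
rewrite /lcexpect /ucexpect => <- <-.
have [_ <-//] := conditioning_members_functional M A mA An0 KAM.
rewrite !ler_pM2r//; apply: (envelope_bounds (fun M' => cexpect M' A)) => // M' KAM'.
by have [] := conditioning_members_functional M' A mA An0 KAM'.
Qed.

(** Centring or reflecting each variable creates no new events of the past,
    so irrelevance of the original variables applies to the centred ones. *)
Lemma defined_by_comp X (g : nat -> R -> R) i A :
  defined_by (fun j w => g j (X j w)) i A -> defined_by X i A.
Proof.
move=> [mA [S AS]]; split => //.
exists [set z | S (\row_(j < i) g j (z ord0 j))].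
rewrite AS; apply/seteqP; split => w /=;
  by congr S; apply/rowP => j; rewrite !mxE.
Qed.

Lemma measurable_mean_within X n eps : (forall i, (i < n)%N -> variable (X i)) ->
  measurable (mean_within K X n eps).
Proof.
move=> vX; have vm : variable (fun w => (\sum_(i < n) X i w) / n%:R).
  by apply: variableM; [exact: variable_sum | exact: variable_cst].
rewrite (_ : mean_within _ _ _ _ =
  [set w | lmu K X n - eps < (\sum_(i < n) X i w) / n%:R] `&`
  [set w | (\sum_(i < n) X i w) / n%:R < umu K X n + eps]).
  by apply: measurableI; apply: measurable_lt_variable => //; exact: variable_cst.
by apply/seteqP; split => w /= => [/andP[]|[? ?]]//; apply/andP.
Qed.

Lemma prob_mean_within X n B eps M : K M -> (0 < n)%N ->
  (forall i, (i < n)%N -> variable (X i)) -> weak_irrelevance su K X n ->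
  (forall i, (i < n)%N -> sup (range (X i)) - inf (range (X i)) <= B) ->
  0 < B -> 0 < eps ->
  1 - 2 * expR (- (2 * n%:R * eps ^+ 2 / B ^+ 2))
    <= prob M (mean_within K X n eps).
Proof.
move=> KM n0 vX wirr rangeX B0 eps0; have HM := expect_functional M KM.
have n0R : 0 < n%:R :> R by rewrite ltr0n.
have boundX i : (i < n)%N -> forall w,
    inf (range (X i)) <= X i w <= inf (range (X i)) + B.
  move=> iltn w; have /variableP[_ [C XC]] := vX i iltn.
  apply/andP; split.
    apply: ge_inf; last by exists w.
    by exists (- C) => _ [v _ <-]; have := XC v; rewrite ler_norml => /andP[].
  apply: (@le_trans _ _ (sup (range (X i)))); last first.
    by rewrite -lerBlDl rangeX.
  apply: ub_le_sup; last by exists w.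
  by exists C => _ [v _ <-]; have := XC v; rewrite ler_norml => /andP[].
pose e := expR (- (2 * n%:R * eps ^+ 2 / B ^+ 2)).
pose Up i w := X i w - uexpect K (X i).
pose Lo i w := lexpect K (X i) - X i w.
have vUp i : (i < n)%N -> variable (Up i).
  by move=> /vX vXi; apply: variableB => //; exact: variable_cst.
have vLo i : (i < n)%N -> variable (Lo i).
  by move=> /vX vXi; apply: variableB => //; exact: variable_cst.
have tailUp : expect M \1_[set w | n%:R * eps <= \sum_(i < n) Up i w] <= e.
  apply: (hoeffding_tail HM) => // [i /boundX bX|i iltn A defA].
    exists (inf (range (X i)) - uexpect K (X i)) => w.
    by have := bX w; rewrite /Up => /andP[? ?]; apply/andP; split; lra.
  have defXA := defined_by_comp X (fun j x => x - uexpect K (X j)) i A defA.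
  have [mA _] := defA; have vA : variable (\1_A : T -> R) := variable_indic A mA.
  under eq_fun do rewrite mulrBl.
  rewrite (expectB HM) ?(expectZ HM)//; last 2 first.
    exact: variableM (vX i iltn) vA.
    exact: variableM (variable_cst _) vA.
  rewrite subr_le0.
  by have /andP[] :=
    weak_irrelevance_expect X n i A M KM (vX i iltn) wirr iltn defXA.
have tailLo : expect M \1_[set w | n%:R * eps <= \sum_(i < n) Lo i w] <= e.
  apply: (hoeffding_tail HM) => // [i /boundX bX|i iltn A defA].
    exists (lexpect K (X i) - inf (range (X i)) - B) => w.
    by have := bX w; rewrite /Lo => /andP[? ?]; apply/andP; split; lra.
  have defXA := defined_by_comp X (fun j x => lexpect K (X j) - x) i A defA.
  have [mA _] := defA; have vA : variable (\1_A : T -> R) := variable_indic A mA.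
  under eq_fun do rewrite mulrBl.
  rewrite (expectB HM) ?(expectZ HM)//; last 2 first.
    exact: variableM (variable_cst _) vA.
    exact: variableM (vX i iltn) vA.
  rewrite subr_le0.
  by have /andP[] :=
    weak_irrelevance_expect X n i A M KM (vX i iltn) wirr iltn defXA.
have vtail (Y : nat -> T -> R) : (forall i, (i < n)%N -> variable (Y i)) ->
    variable (\1_[set w | n%:R * eps <= \sum_(i < n) Y i w] : T -> R).
  move=> vY; apply: variable_indic; apply: measurable_le_variable.
    exact: variable_cst.
  exact: variable_sum.
have vG : variable (\1_(mean_within K X n eps) : T -> R) :=
  variable_indic _ (measurable_mean_within X n eps vX).
(* Outside mean_within, one of the two centred sums reaches n * eps. *)
have cover : 1 <= prob M (mean_within K X n eps) +
    (expect M \1_[set w | n%:R * eps <= \sum_(i < n) Up i w] +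
     expect M \1_[set w | n%:R * eps <= \sum_(i < n) Lo i w]).
  have vT := variableD _ _ (vtail Up vUp) (vtail Lo vLo).
  rewrite -(expectD HM); [|exact: vtail..].
  rewrite -(expectD HM)// -[leLHS](expect_cst HM).
  apply: (le_expect HM) => [||w]; first exact: variable_cst.
    exact: variableD.
  rewrite !indicE.
  have [_|] := boolP (w \in mean_within K X n eps).
    by rewrite mulr1n lerDl addr_ge0.
  rewrite notin_setE /mean_within /= => /negP; rewrite negb_and -!leNgt.
  rewrite mulr0n add0r.
  have umuE : umu K X n = (\sum_(i < n) uexpect K (X i)) / n%:R by rewrite mulrC.
  have lmuE : lmu K X n = (\sum_(i < n) lexpect K (X i)) / n%:R by rewrite mulrC.
  case/orP => [h|h].
    rewrite [X in _ + X](_ : _ = 1) ?lerDr//.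
    rewrite mem_set//= /Lo sumrB.
    move: h; rewrite lmuE ler_pdivrMr// mulrBl divfK ?gt_eqF//; lra.
  rewrite [X in X + _](_ : _ = 1) ?lerDl//.
  rewrite mem_set//= /Up sumrB.
  move: h; rewrite umuE ler_pdivlMr// mulrDl divfK ?gt_eqF//; lra.
rewrite -/e; lra.
Qed.

Lemma lprob_ge A c : K !=set0 -> (forall M, K M -> c <= prob M A) ->
  c <= lprob K A.
Proof.
move=> [M0 KM0] cP; apply: lb_le_inf; first by exists (prob M0 A), M0.
by move=> _ [M KM <-]; exact: cP.
Qed.

Lemma prob_forall_range (G : nat -> set T) (q : nat -> R) (N m : nat) M : K M ->
  (forall n, measurable (G n)) ->
  (forall n, (N <= n)%N -> 1 - q n <= prob M (G n)) ->
  1 - \sum_(j < m) q (N + j)%N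
    <= prob M [set w | forall n, (N <= n < N + m)%N -> G n w].
Proof.
move=> KM mG qG; have HM := expect_functional M KM.
suff [] : measurable [set w | forall n, (N <= n < N + m)%N -> G n w] /\
  1 - \sum_(j < m) q (N + j)%N
    <= prob M [set w | forall n, (N <= n < N + m)%N -> G n w] by [].
elim: m => [|m [mH IH]].
  rewrite (_ : [set w | _] = setT); last first.
    apply/seteqP; split => // w _ n; rewrite addn0 => /andP[Nn nN].
    by move: (leq_ltn_trans Nn nN); rewrite ltnn.
  by rewrite big_ord0 subr0 /prob indicT (expect_cst HM).
set H := [set w | _] in mH IH.
rewrite (_ : [set w | _] = H `&` G (N + m)%N); last first.
  apply/seteqP; split => [w /= Hw|w /= [Hw GNm] n].
    split => [n /andP[Nn nm]|].
      by apply: Hw; rewrite Nn addnS ltnW.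
    by apply: Hw; rewrite leq_addr addnS/=.
  rewrite addnS ltnS => /andP[Nn]; rewrite leq_eqVlt => /predU1P[->//|nm].
  by apply: Hw; rewrite Nn.
split; first exact: measurableI.
have vH : variable (\1_H : T -> R) := variable_indic H mH.
have vG : variable (\1_(G (N + m)%N) : T -> R) := variable_indic _ (mG _).
have vHG : variable (\1_(H `&` G (N + m)%N) : T -> R) :=
  variable_indic _ (measurableI _ _ mH (mG (N + m)%N)).
have bonferroni : prob M H + prob M (G (N + m)%N) <= prob M (H `&` G (N + m)%N) + 1.
  rewrite /prob -(expectD HM)// -[X in _ <= _ + X](expect_cst HM).
  rewrite -(expectD HM)//; last exact: variable_cst.
  apply: (le_expect HM) => [||w].
  - exact: variableD.
  - by apply: variableD => //; exact: variable_cst.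
  - by rewrite !indicE in_setI; case: (w \in H); case: (w \in G _);
      rewrite /= ?mulr1n ?mulr0n; lra.
have := qG (N + m)%N (leq_addr _ _).
rewrite big_ord_recr/=; lra.
Qed.

End CredalSetBounds.

(** * The weak and the finite strong law *)

Lemma sum_geometric_tail_lt (R : realType) (r e : R) : 0 <= r < 1 -> 0 < e ->
  exists N : nat, (0 < N)%N /\ forall m : nat, \sum_(j < m) r ^+ (N + j) < e.
Proof.
move=> /andP[r0 r1] e0; have r1' : 0 < 1 - r by rewrite subr_gt0.
have := @cvg_expr R r; rewrite ger0_norm// => /(_ r1).
move=> /cvgrPdist_lt/(_ _ (mulr_gt0 e0 r1'))[N _ HN].
exists N.+1; split => // m.
have rN : r ^+ N.+1 < e * (1 - r).
  have := HN N.+1 (leqnSn N).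
  by rewrite /= sub0r normrN ger0_norm// exprn_ge0.
rewrite -(ltr_pM2r r1') (le_lt_trans _ rN)//.
under eq_bigr do rewrite exprD.
rewrite -mulr_sumr -mulrA [_ * (1 - r)]mulrC -[1 - r]opprB mulNr -subrX1 opprB.
by rewrite ler_piMr ?exprn_ge0// lerBlDr lerDl exprn_ge0.
Qed.

Theorem theorem3 (d : measure_display) (T : measurableType d) (R : realType)
    (su : setup) (K : set (member T R))
    (K_nonempty : K !=set0)
    (K_admissible : forall M, K M -> admissible_member su M)
    (K_framework : framework K) :
  (forall (n : nat) (X : nat -> T -> R) (Bs : nat -> R) (B : R),
     (0 < n)%N ->
     (forall i, (i < n)%N -> variable (X i)) ->
     disintegrability su K X [set i | (i < n)%N] ->
     weak_irrelevance su K X n ->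
     (forall i, (i < n)%N -> sup (range (X i)) - inf (range (X i)) <= Bs i) ->
     B = \big[Num.max/Bs 0%N]_(i < n) Bs i ->
     0 < B ->
     forall eps : R, 0 < eps ->
       lprob K (mean_within K X n eps) >=
         1 - 2 * expR (- (2 * n%:R * eps ^+ 2 / B ^+ 2)))
  /\
  (forall (X : nat -> T -> R) (Bs : nat -> R) (B : R),
     (forall i, variable (X i)) ->
     disintegrability su K X [set: nat] ->
     (forall n, (0 < n)%N -> weak_irrelevance su K X n) ->
     (forall i, sup (range (X i)) - inf (range (X i)) <= Bs i) ->
     has_ubound (range Bs) ->
     B = sup (range Bs) ->
     0 < B ->
     forall eps : R, 0 < eps ->
       exists N : nat, (0 < N)%N /\
         forall N' : nat, (0 < N')%N ->
           lprob K [set w | forall n : nat, (N <= n <= N + N')%N ->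
                              mean_within K X n eps w] > 1 - 2 * eps).
Proof.
split.
  move=> n X Bs B n0 vX _ wirr rangeX BE B0 eps eps0.
  apply: lprob_ge => // M KM.
  apply: (prob_mean_within _ _ K_admissible) => // i iltn.
  apply: le_trans (rangeX i iltn) _; rewrite BE.
  exact: (le_bigmax _ (fun j : 'I_n => Bs j) (Ordinal iltn)).
move=> X Bs B vX _ wirr rangeX Bs_bounded BE B0 eps eps0.
have rangeB i : sup (range (X i)) - inf (range (X i)) <= B.
  by rewrite (le_trans (rangeX i))// BE; apply: ub_le_sup => //; exists i.
pose r := expR (- (2 * eps ^+ 2 / B ^+ 2)).
have r01 : 0 <= r < 1.
  rewrite expR_ge0 expR_lt1 oppr_lt0 divr_gt0 ?exprn_gt0//.
  by apply: mulr_gt0; rewrite ?exprn_gt0.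
have [N [N0 tailN]] := sum_geometric_tail_lt R r eps r01 eps0.
exists N; split => // N' _.
apply: (@lt_le_trans _ _ (1 - 2 * \sum_(j < N'.+1) r ^+ (N + j))).
  by have := tailN N'.+1; lra.
apply: lprob_ge => // M KM.
rewrite (_ : [set w | _] =
    [set w | forall n, (N <= n < N + N'.+1)%N -> mean_within K X n eps w]); last first.
  by rewrite addnS; under [RHS]eq_set do under eq_forall do rewrite ltnS.
rewrite mulr_sumr.
apply: (prob_forall_range su K K_admissible
  (fun n => mean_within K X n eps) (fun n => 2 * r ^+ n)) => // n.
  by apply: measurable_mean_within => i _.
move=> Nn; have n0 : (0 < n)%N := leq_trans N0 Nn.
have -> : r ^+ n = expR (- (2 * n%:R * eps ^+ 2 / B ^+ 2)).
  by rewrite -expRM_natl; congr expR; field; rewrite gt_eqF.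
exact: (prob_mean_within su K K_admissible X n B eps M KM n0
  (fun i _ => vX i) (wirr n n0) (fun i _ => rangeB i) B0 eps0).
Qed.
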